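(* When $n\ge 2$, the non-trivial (i.e. non-constant) equivariant harmonic maps from $\mathbb{C}^n$ to $\mathbb{CP}^n$ all have infinite energy. That is, if $u:[0,\infty)\to\mathbb{S}^2$ is a non-constant solution of $$0=u\times\left(u_{rr}+\frac{2n-1}{r}u_r+\frac{2n-2+u_3}{r^2}e_3\right),\quad r>0,\qquad u(0)=e_3,$$ then $\mathcal{E}(u)=\infty$.
   Context: $\mathbb{S}^2\subset\mathbb{R}^3$ is the unit sphere, $e_3=(0,0,1)$, $u=(u_1,u_2,u_3)$, $\times$ is the cross product; solutions are $C^1$ on $[0,\infty)$ and $C^2$ on $(0,\infty)$. The function $u$ is viewed as a radial map on $\mathbb{R}^{2n}$, $r=|x|$, and its energy is $$\mathcal{E}(u)=\frac12\int_{\mathbb{R}^{2n}}\left(|u_r|^2+\frac{u_1^2+u_2^2+(2n-2)|u-e_3|^2}{r^2}\right)dx\in[0,\infty].$$ An equivariant map $v:\mathbb{C}^n\to\mathbb{CP}^n$ is encoded by $u$ through $v(z)=\left[1+u_3(r),(u_1(r)+iu_2(r))\frac zr\right]$ (homogeneous coordinates), $r=|z|$; the displayed ODE is the harmonic map equation in this representation and $\mathcal{E}(u)$ is the energy of $v$. *)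

(* Defs.v *)
From HB Require Import structures.
From mathcomp Require Import all_boot all_order all_algebra.
From mathcomp Require Import all_classical all_reals all_analysis.

Set Implicit Arguments.
Unset Strict Implicit.
Unset Printing Implicit Defensive.

Import Order.TTheory GRing.Theory Num.Theory.
Import numFieldNormedType.Exports.

Local Open Scope classical_set_scope.
Local Open Scope ring_scope.

(* [lebesgue_measure] lives on [measurableTypeR R], whose display differs from
   the one of the default measurable structure on [R], hence this type. *)
Notation Rn R m := (m.-tuple (measurableTypeR R)).

Section LebesgueMeasureRn.
Variable R : realType.

Definition tcons m (p : Rn R m * measurableTypeR R) : Rn R m.+1 :=
  [tuple of p.2 :: p.1].

Lemma measurable_tcons m : measurable_fun setT (@tcons m).
Proof. exact: measurable_cons. Qed.

(* The law of [tcons] under [mu \x lebesgue_measure]. The instance is named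
   because it cannot be inferred: it takes the measurability of [tcons]. *)
Definition lebesgue_tcons m (mu : {measure set (Rn R m) -> \bar R}) :
    {measure set (Rn R m.+1) -> \bar R} :=
  measure_function_pushforward__canonical__measure_function_Measure
    (mu \x (@lebesgue_measure R))%E (@measurable_tcons m).

Fixpoint lebesgue_Rn m : {measure set (Rn R m) -> \bar R} :=
  match m with
  | 0 => \d_([tuple] : Rn R 0)
  | k.+1 => lebesgue_tcons (lebesgue_Rn k)
  end.

Lemma lebesgue_Rn_box m (A : 'I_m -> set (measurableTypeR R)) :
  (forall i, measurable (A i)) ->
  lebesgue_Rn m [set x | forall i, A i (tnth x i)] =
  (\prod_(i < m) lebesgue_measure (A i))%E.
Proof.
elim: m A => [|m IHm] A mA.
  by rewrite big_ord0 /= diracE mem_set // => -[].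
rewrite big_ord_recl /= /pushforward.
have -> : @tcons m @^-1` [set x | forall i, A i (tnth x i)] =
    [set x | forall i, A (lift ord0 i) (tnth x i)] `*` A ord0.
  apply/seteqP; split => -[x y] /=.
    move=> Axy; split => [i|]; last by have := Axy ord0; rewrite tnth0.
    by have := Axy (lift ord0 i); rewrite tnthS.
  move=> [Ax Ay] i; case: (unliftP ord0 i) => [j|] ->; first by rewrite tnthS.
  by rewrite tnth0.
have mB : measurable [set x : Rn R m | forall i, A (lift ord0 i) (tnth x i)].
  have -> : [set x : Rn R m | forall i, A (lift ord0 i) (tnth x i)] =
      \big[setI/setT]_(i < m) ((fun x => tnth x i) @^-1` A (lift ord0 i)).
    rewrite -bigcap_seq; apply/seteqP; split => x /= Ax i.
      by move=> _; exact: Ax.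
    by apply: Ax; rewrite /= mem_index_enum.
  apply: bigsetI_measurable => i _.
  by rewrite -[X in measurable X]setTI; exact: measurable_tnth.
rewrite -(IHm (fun i => A (lift ord0 i))); last by move=> i; exact: mA.
rewrite muleC.
exact: (product_measure1E (lebesgue_Rn m) (@lebesgue_measure R) mB (mA ord0)).
Qed.

End LebesgueMeasureRn.

Section HarmonicMap.
Variable R : realType.

(* The library norm on row vectors is the sup norm; the Euclidean one is meant
   throughout. *)
Definition sqnorm m (v : 'rV[R]_m) : R := \sum_(i < m) v 0 i ^+ 2.

Definition enorm m (x : Rn R m) : R := Num.sqrt (\sum_(i < m) tnth x i ^+ 2).

(* [i + 1] and [i + 2] are taken in ['I_3], that is, modulo 3. *)
Definition crossv (v w : 'rV[R]_3) : 'rV[R]_3 :=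
  \row_(i < 3) (v 0 (i + 1) * w 0 (i + 2) - v 0 (i + 2) * w 0 (i + 1)).

Definition e3 : 'rV[R]_3 := delta_mx 0 2.

(* The derivative at the endpoint [0] is the one-sided derivative; values of
   [u] at negative arguments play no role. *)
Definition C1_halfline (V : normedModType R) (u : R -> V) : Prop :=
  exists du : R -> V,
    [/\ h^-1 *: (u h - u 0) @[h --> 0^'+] --> du 0,
        forall r : R, 0 < r -> is_derive r 1 u (du r) &
        {within `[0, +oo[, continuous du}].

Definition C2_open_halfline (V : normedModType R) (u : R -> V) : Prop :=
  forall r : R, 0 < r ->
    [/\ derivable u r 1, derivable (derive1 u) r 1 &
        {for r, continuous (derive1 (derive1 u))}].

(* The coordinates (u_1, u_2, u_3) are [u r 0 0], [u r 0 1], [u r 0 2]. *)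
Definition harmonic_profile (n : nat) (u : R -> 'rV[R]_3) : Prop :=
  [/\ forall r : R, 0 <= r -> sqnorm (u r) = 1,
      C1_halfline u, C2_open_halfline u, u 0 = e3 &
      forall r : R, 0 < r ->
        0 = crossv (u r)
              (derive1 (derive1 u) r + ((2 * n%:R - 1) / r) *: derive1 u r
               + ((2 * n%:R - 2 + u r 0 2) / r ^+ 2) *: e3)].

(* At [r = 0] the value is junk ([_ / 0 = 0]); this affects a null set only. *)
Definition energy_density (n : nat) (u : R -> 'rV[R]_3) (r : R) : R :=
  sqnorm (derive1 u r)
  + (u r 0 0 ^+ 2 + u r 0 1 ^+ 2 + (2 * n%:R - 2) * sqnorm (u r - e3)) / r ^+ 2.

Definition energy (n : nat) (u : R -> 'rV[R]_3) : \bar R :=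
  ((2^-1)%:E * \int[lebesgue_Rn R (2 * n)%N]_x (energy_density n u (enorm x))%:E)%E.

End HarmonicMap.

(* Main.v *)
(* Put F(r) = r^2 |u'|^2 - W(u_3) with W(y) = (1 - y)(4n - 3 + y), so that the
   energy density is |u'|^2 + W(u_3)/r^2 for a sphere-valued u. The equation
   says that its bracket is parallel to u, hence orthogonal to u'; this gives
   the Pohozaev identity F'(r) = -(4n - 4) r |u'|^2. As F(0+) <= 0, either F
   vanishes identically, and then so does u', or F <= -c < 0 from some radius
   on. In the latter case the density is at least c/r^2 at infinity, so the
   energy on the cube [L, 2L]^(2n) is at least of order L^(2n - 2). *)

Require Import Defs.
From mathcomp Require Import all_boot all_order all_algebra.
From mathcomp Require Import all_classical all_reals all_analysis.
From mathcomp Require Import ring lra.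
Import Order.TTheory GRing.Theory Num.Theory.
Import numFieldNormedType.Exports.

Set Implicit Arguments.
Unset Strict Implicit.
Unset Printing Implicit Defensive.

Local Open Scope classical_set_scope.
Local Open Scope ring_scope.

(** * Lower bounds for integrals, and cubes in Euclidean space *)

Section Integral.
Import HBNNSimple.
Local Open Scope ereal_scope.

(* [f] need not be measurable: the integral of a nonnegative function is the
   supremum over the simple functions below it. *)
Lemma integral_ge_cst_on d (T : measurableType d) (R : realType)
    (mu : {measure set T -> \bar R}) (f : T -> R) (A : set T) (k : R) :
  measurable A -> (0 <= k)%R -> (forall x, 0 <= f x)%R ->
  (forall x, A x -> k <= f x)%R ->
  k%:E * mu A <= \int[mu]_x (f x)%:E.
Proof.
move=> mA k0 f0 kf.
rewrite ge0_integralTE; last by move=> x; rewrite lee_fin.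
apply: ereal_sup_ubound; exists (scale_nnsfun (indic_nnsfun R mA) k0) => /=.
  move=> x; rewrite lee_fin -[leLHS]/(k * \1_A x)%R indicE.
  by have [/set_mem/kf|_] := boolP (x \in A); rewrite ?mulr1 ?mulr0.
by rewrite sintegralrM sintegral_indic.
Qed.

Lemma measurable_box (R : realType) m (A : 'I_m -> set (measurableTypeR R)) :
  (forall i, measurable (A i)) ->
  measurable [set x : Rn R m | forall i, A i (tnth x i)].
Proof.
move=> mA.
rewrite (_ : [set x | _] = \big[setI/setT]_(i < m) ((fun x => tnth x i) @^-1` A i)).
  apply: bigsetI_measurable => i _.
  by rewrite -[X in measurable X]setTI; exact: measurable_tnth.
rewrite -bigcap_seq; apply/seteqP; split => x /= Ax i; first by move=> _; exact: Ax.
by apply: Ax; rewrite /= mem_index_enum.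
Qed.

Lemma lebesgue_Rn_cube (R : realType) m (a b : R) : (a < b)%R ->
  lebesgue_Rn R m [set x | forall i, `[a, b]%classic (tnth x i)] =
  ((b - a) ^+ m)%:E.
Proof.
move=> ab; rewrite (@lebesgue_Rn_box R m
    (fun=> [set` `[a, b]] : set (measurableTypeR R))); last first.
  by move=> i; exact: measurable_itv.
under eq_bigr do rewrite lebesgue_measure_itv /= lte_fin ab -EFinB.
by rewrite prodEFin prodr_const card_ord.
Qed.

End Integral.

Lemma enorm_ge0 (R : realType) m (x : Rn R m) : 0 <= enorm x.
Proof. exact: sqrtr_ge0. Qed.

(** On the cube [[L, 2L]^m] a decay bound in [enorm x] becomes a constant: one coordinate alone
    already forces the norm above [L], and each of the [m] squares is at most [(2L)^2]. *)
Lemma enorm_cube (R : realType) m (L : R) (x : Rn R m) : (0 < m)%N -> 0 <= L ->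
  (forall i, L <= tnth x i <= 2 * L) ->
  L <= enorm x /\ enorm x ^+ 2 <= m%:R * (4 * L ^+ 2).
Proof.
move=> m0 L0 xL; have sge0 : 0 <= \sum_(i < m) tnth x i ^+ 2.
  by apply: sumr_ge0 => i _; exact: sqr_ge0.
rewrite /enorm sqr_sqrtr //; split.
  rewrite -(ger0_norm L0) -sqrtr_sqr ler_wsqrtr //.
  rewrite (bigD1 (Ordinal m0)) //= -[leLHS]addr0 lerD //.
    by have /andP[xl _] := xL (Ordinal m0); rewrite lerXn2r ?nnegrE // (le_trans L0).
  by apply: sumr_ge0 => i _; exact: sqr_ge0.
rewrite -[m in m%:R]card_ord mulr_natl -sumr_const ler_sum // => i _.
have /andP[xl xr] := xL i.
rewrite (_ : 4 * _ = (2 * L) ^+ 2); last by rewrite exprMn; congr (_ * _); ring.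
rewrite lerXn2r ?nnegrE ?mulr_ge0 //; exact: le_trans xl.
Qed.

(** * Vector algebra in three dimensions *)

Lemma sum3E (V : nmodType) (F : 'I_3 -> V) : \sum_(i < 3) F i = F 0 + F 1 + F 2.
Proof.
rewrite !big_ord_recl big_ord0 addr0 addrA.
by congr (F _ + F _ + F _); exact: val_inj.
Qed.

Lemma sqnorm3E (R : realType) (v : 'rV[R]_3) :
  sqnorm v = v 0 0 ^+ 2 + v 0 1 ^+ 2 + v 0 2 ^+ 2.
Proof. exact: sum3E. Qed.

Lemma sqnorm_ge0 (R : realType) m (v : 'rV[R]_m) : 0 <= sqnorm v.
Proof. by apply: sumr_ge0 => i _; exact: sqr_ge0. Qed.

Lemma sqnorm_eq0 (R : realType) m (v : 'rV[R]_m) : sqnorm v = 0 -> v = 0.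
Proof.
move=> /eqP; rewrite psumr_eq0; last by move=> i _; exact: sqr_ge0.
move=> /allP v0; apply/rowP => i; rewrite mxE.
by have := v0 i (mem_index_enum i); rewrite sqrf_eq0 => /eqP.
Qed.

Lemma crossv0 (R : realType) (u G : 'rV[R]_3) : 0 = crossv u G ->
  [/\ u 0 1 * G 0 2 = u 0 2 * G 0 1, u 0 2 * G 0 0 = u 0 0 * G 0 2 &
      u 0 0 * G 0 1 = u 0 1 * G 0 0].
Proof.
move=> /rowP uG.
have i01 : (0 + 1 : 'I_3) = 1 by exact: val_inj.
have i02 : (0 + 2 : 'I_3) = 2 by exact: val_inj.
have i11 : (1 + 1 : 'I_3) = 2 by exact: val_inj.
have i12 : (1 + 2 : 'I_3) = 0 by exact: val_inj.
have i21 : (2 + 1 : 'I_3) = 0 by exact: val_inj.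
have i22 : (2 + 2 : 'I_3) = 1 by exact: val_inj.
split; apply/eqP; rewrite -subr_eq0; apply/eqP.
- by have := uG 0; rewrite !mxE i01 i02.
- by have := uG 1; rewrite !mxE i11 i12.
- by have := uG 2; rewrite !mxE i21 i22.
Qed.

(* A vector parallel to the unit vector [u] is orthogonal to the tangent
   vectors at [u]. *)
Lemma crossv0_tangent (R : realType) (u G v : 'rV[R]_3) :
  sqnorm u = 1 -> u 0 0 * v 0 0 + u 0 1 * v 0 1 + u 0 2 * v 0 2 = 0 ->
  0 = crossv u G -> G 0 0 * v 0 0 + G 0 1 * v 0 1 + G 0 2 * v 0 2 = 0.
Proof.
rewrite sqnorm3E => u1 uv /crossv0[e0 e1 e2].
move: (u 0 0) (u 0 1) (u 0 2) (v 0 0) (v 0 1) (v 0 2) (G 0 0) (G 0 1) (G 0 2)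
  u1 uv e0 e1 e2 => a b c x y z p q s u1 uv e0 e1 e2.
have -> : p * x + q * y + s * z =
    (a ^+ 2 + b ^+ 2 + c ^+ 2) * (p * x + q * y + s * z).
  by rewrite u1 mul1r.
(* The Binet-Cauchy identity |u|^2 (G.v) = (u.G)(u.v) + (u x G).(u x v); both terms on the right
   vanish. *)
have -> : (a ^+ 2 + b ^+ 2 + c ^+ 2) * (p * x + q * y + s * z) =
    (a * p + b * q + c * s) * (a * x + b * y + c * z)
    + (b * s - c * q) * (b * z - c * y) + (c * p - a * s) * (c * x - a * z)
    + (a * q - b * p) * (a * y - b * x) by ring.
by rewrite uv e0 e1 e2 !subrr !mul0r mulr0 !addr0.
Qed.

(** * Differentiation along a profile and the Pohozaev identity *)

Lemma is_derive_coord (R : realType) m n (M : R -> 'M[R]_(m, n)) (t : R) dM i j :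
  is_derive t 1 M dM -> is_derive t 1 (fun x => M x i j) (dM i j).
Proof.
move=> [Mt <-]; rewrite derive_mx // mxE.
by apply: DeriveDef => //; exact: (derivable_mxP M t 1).1.
Qed.

Lemma derivable_is_derive1 (R : realType) (V : normedModType R) (f : R -> V) (t : R) :
  derivable f t 1 -> is_derive t 1 f (derive1 f t).
Proof. by move=> ft; rewrite derive1E; exact: DeriveDef. Qed.

(** Near [r] the sum of squares agrees with the constant 1, so its derivative 2 u.u' is zero. *)
Lemma derive_unit_sphere (R : realType) (u : R -> 'rV[R]_3) (r : R) :
  (\forall t \near r, sqnorm (u t) = 1) -> derivable u r 1 ->
  u r 0 0 * derive1 u r 0 0 + u r 0 1 * derive1 u r 0 1
    + u r 0 2 * derive1 u r 0 2 = 0.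
Proof.
move=> u1 ud; have du := derivable_is_derive1 ud.
have da := is_derive_coord 0 0 du.
have db := is_derive_coord 0 1 du.
have dc := is_derive_coord 0 2 du.
have ds := is_deriveD (is_deriveD (is_deriveX 2 da) (is_deriveX 2 db)) (is_deriveX 2 dc).
have := @near_eq_is_derive R _ _ _ (cst 1 : R -> R) r 1 _ _ ds.
case=> [|_].
  by near=> t; rewrite /= -[RHS](near u1 t) // sqnorm3E !fctE.
rewrite derive_cst /GRing.scale /= !expr1 => h; lra.
Unshelve. all: by end_near. Qed.

(** To be read with [p], [q], [s] the coordinates of u', with [c] = u_3, and with [k] = 4n - 4, so
    that the subtracted product is W(u_3) and W'(y) = -(k + 2y). *)
Lemma is_derive_pohozaev (R : realType) (k r : R) (p q s c : R -> R) (p' q' s' : R) :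
  is_derive r 1 p p' -> is_derive r 1 q q' -> is_derive r 1 s s' ->
  is_derive r 1 c (s r) ->
  is_derive r 1
    (fun t => t ^+ 2 * (p t ^+ 2 + q t ^+ 2 + s t ^+ 2) - (1 - c t) * (k + 1 + c t))
    (2 * r * (p r ^+ 2 + q r ^+ 2 + s r ^+ 2)
      + 2 * r ^+ 2 * (p' * p r + q' * q r + s' * s r) + (k + 2 * c r) * s r).
Proof.
move=> dp dq ds dc.
have dF := is_deriveB
  (is_deriveM (is_deriveX 2 (is_derive_id r 1))
     (is_deriveD (is_deriveD (is_deriveX 2 dp) (is_deriveX 2 dq)) (is_deriveX 2 ds)))
  (is_deriveM (is_deriveB (is_derive_cst (1 : R) r 1) dc)
     (is_deriveD (is_derive_cst (k + 1 : R) r 1) dc)).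
set F := (fun t => _); set F1 := (X in is_derive r 1 X _) in dF.
have FE : F1 = F by apply/funext => t; rewrite /F1 /F !fctE.
rewrite -FE; apply: (is_derive_eq dF).
rewrite !fctE /GRing.scale /=; ring.
Qed.

Lemma is_derive0_cst_halfline (R : realType) (f : R -> R) (a r : R) :
  {within `[a, +oo[, continuous f} -> (forall t, a < t -> is_derive t 1 f 0) ->
  a <= r -> f r = f a.
Proof.
move=> cf df ar; apply/eqP; rewrite eq_le; apply/andP; split.
  apply: (@ler0_derive1_nincry _ _ a) => // t; rewrite in_itv /= andbT => /df [] // _.
  by rewrite derive1E => ->.
apply: (@ger0_derive1_ndecry _ _ a) => // t; rewrite in_itv /= andbT => /df [] // _.
by rewrite derive1E => ->.
Qed.

(* The function F of the header. *)
Definition pohozaev (R : realType) (n : nat) (u : R -> 'rV[R]_3) (r : R) : R :=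
  r ^+ 2 * sqnorm (derive1 u r) - (1 - u r 0 2) * (4 * n%:R - 3 + u r 0 2).

Lemma is_derive_pohozaev_profile (R : realType) (n : nat) (u : R -> 'rV[R]_3) (r : R) :
  harmonic_profile n u -> 0 < r ->
  is_derive r 1 (pohozaev n u) (- (4 * n%:R - 4) * r * sqnorm (derive1 u r)).
Proof.
move=> [u1 _ C2 _ ode] r0; have [du ddu _] := C2 r r0.
have u1r : \forall t \near r, sqnorm (u t) = 1.
  by near=> t; apply: u1; apply: ltW; near: t; exact: lt_nbhsr.
have tangent := crossv0_tangent (u1 _ (ltW r0)) (derive_unit_sphere u1r du) (ode r r0).
have dcoord i := is_derive_coord 0 i (derivable_is_derive1 ddu).
have duc := is_derive_coord 0 2 (derivable_is_derive1 du).
have dF := is_derive_pohozaev (4 * n%:R - 4) (dcoord 0) (dcoord 1) (dcoord 2) duc.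
have -> : pohozaev n u = fun t : R => t ^+ 2 *
    (derive1 u t 0 0 ^+ 2 + derive1 u t 0 1 ^+ 2 + derive1 u t 0 2 ^+ 2)
    - (1 - u t 0 2) * (4 * n%:R - 4 + 1 + u t 0 2).
  by apply/funext => t; rewrite /pohozaev sqnorm3E; congr (_ - _ * _); ring.
apply: (is_derive_eq dF).
move: tangent; rewrite !mxE /= !mulr0 !mulr1 !addr0 sqnorm3E.
move: (derive1 u r 0 0) (derive1 u r 0 1) (derive1 u r 0 2) => p q s.
move: (derive1 (derive1 u) r 0 0) (derive1 (derive1 u) r 0 1) (derive1 (derive1 u) r 0 2)
  (u r 0 2) => p' q' s' c h.
(* The derivative is regrouped so that 2r^2 multiplies the inner product of the bracket with u',
   which is zero by [h]. What remains is 2r|u'|^2 - 2(2n - 1)r|u'|^2. *)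
transitivity (2 * r * (p ^+ 2 + q ^+ 2 + s ^+ 2)
    - 2 * (2 * n%:R - 1) * r * (p ^+ 2 + q ^+ 2 + s ^+ 2)
    + 2 * r ^+ 2 * ((p' + (2 * n%:R - 1) / r * p) * p
       + (q' + (2 * n%:R - 1) / r * q) * q
       + (s' + (2 * n%:R - 1) / r * s + (2 * n%:R - 2 + c) / r ^+ 2) * s)).
  by field; rewrite gt_eqF.
by rewrite h; ring.
Unshelve. all: by end_near. Qed.

Lemma unit_coord_bounds (R : realType) (v : 'rV[R]_3) (i : 'I_3) :
  sqnorm v = 1 -> -1 <= v 0 i <= 1.
Proof.
move=> v1; rewrite -ler_norml -(@expr_le1 _ 2) // real_normK ?num_real //.
rewrite -v1 /sqnorm (bigD1 i) //= lerDl; apply: sumr_ge0 => j _; exact: sqr_ge0.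
Qed.

(** * Sign and monotonicity of F, and decay of the energy density *)

Section Profile.
Variables (R : realType) (n : nat) (u : R -> 'rV[R]_3).
Hypotheses (n2 : (2 <= n)%N) (hu : harmonic_profile n u).

Let n2R : 2 <= n%:R :> R.
Proof. by rewrite (ler_nat _ 2). Qed.

(** Since |u_3| <= 1 and 4n - 3 >= 5, both factors are nonnegative. *)
Lemma potential_ge0 (r : R) : 0 <= r ->
  0 <= (1 - u r 0 2) * (4 * n%:R - 3 + u r 0 2).
Proof.
move=> r0; have [u1 _ _ _ _] := hu.
have /andP[ul ur] := unit_coord_bounds 2 (u1 r r0).
by apply: mulr_ge0; have := n2R; lra.
Qed.

(** On the sphere u_1^2 + u_2^2 = (1 - u_3)(1 + u_3) and |u - e_3|^2 = 2(1 - u_3), so 1 - u_3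
    factors out. *)
Lemma energy_densityE (r : R) : 0 < r ->
  energy_density n u r = sqnorm (derive1 u r)
    + (1 - u r 0 2) * (4 * n%:R - 3 + u r 0 2) / r ^+ 2.
Proof.
move=> r0; have [u1 _ _ _ _] := hu; have := u1 r (ltW r0).
rewrite /energy_density !(sqnorm3E (u r)) (sqnorm3E (u r - e3 R)) => u1r.
congr (_ + _ / _); rewrite !mxE /= !subr0.
move: (u r 0 0) (u r 0 1) (u r 0 2) u1r => a b c u1r.
have -> : a ^+ 2 = 1 - b ^+ 2 - c ^+ 2 by rewrite -u1r; ring.
ring.
Qed.

Lemma energy_density_ge0 (r : R) : 0 <= r -> 0 <= energy_density n u r.
Proof.
rewrite le0r => /orP[/eqP->|r0].
  (* At radius 0 the quotient is 0 by convention, and only the square of the derivative is left. *)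
  by rewrite /energy_density expr0n /= invr0 mulr0 addr0 sqnorm_ge0.
rewrite energy_densityE // addr_ge0 ?sqnorm_ge0 // divr_ge0 ?sqr_ge0 //.
exact/potential_ge0/ltW.
Qed.

(** The Pohozaev identity holds at positive radii only, hence the start at [s > 0]; the limit at 0
    is left to [pohozaev_le0]. *)
Lemma pohozaev_nincr (s r : R) : 0 < s -> s <= r -> pohozaev n u r <= pohozaev n u s.
Proof.
move=> s0 sr.
have dF (t : R) : s <= t ->
    is_derive t 1 (pohozaev n u) (- (4 * n%:R - 4) * t * sqnorm (derive1 u t)).
  by move=> st; apply: is_derive_pohozaev_profile => //; exact: lt_le_trans st.
apply: (@ler0_derive1_nincry _ _ s) => //.
- by move=> t; rewrite in_itv /= andbT => /ltW/dF[].
- move=> t; rewrite in_itv /= andbT => st; have [_ dFt] := dF t (ltW st).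
  rewrite derive1E dFt !mulNr oppr_le0 mulr_ge0 ?sqnorm_ge0 // mulr_ge0 //.
    by have := n2R; lra.
  exact/ltW/(lt_trans s0).
- apply/continuous_within_itvcyP; split.
    move=> t; rewrite in_itv /= andbT => /ltW/dF[dt _].
    exact/differentiable_continuous/derivable1_diffP.
  apply: cvg_at_right_filter; have [dt _] := dF s (lexx s).
  exact/differentiable_continuous/derivable1_diffP.
Qed.

(* [F s <= s^2 |u'(s)|^2], and [u'] is bounded near [0]. *)
Lemma pohozaev_le0 (r : R) : 0 < r -> pohozaev n u r <= 0.
Proof.
move=> r0; have [u1 [du [_ dudu cdu]] _ _ _] := hu.
have /continuous_within_itvcyP[_ du0] := cdu.
have coord0 i : (s * du s 0 i) ^+ 2 @[s --> 0^'+] --> (0 : R).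
  rewrite -[X in _ --> X](_ : (0 * du 0 0 i) ^+ 2 = 0); last by rewrite mul0r expr0n.
  have h : s * du s 0 i @[s --> 0^'+] --> 0 * du 0 0 i.
    apply: cvgM; first exact: cvg_at_right_filter.
    apply: (cvg_comp du (fun M : 'rV[R]_3 => M 0 i) du0); exact: coord_continuous.
  by rewrite !expr2; exact: (cvgM h h).
have sq0 : (s * du s 0 0) ^+ 2 +
    (s * du s 0 1) ^+ 2 + (s * du s 0 2) ^+ 2 @[s --> 0^'+] --> (0 : R).
  rewrite -[X in _ --> X](addr0 0) -[X in _ --> X + _](addr0 0).
  exact: (cvgD (cvgD (coord0 0) (coord0 1)) (coord0 2)).
(* With [r] fixed and [s] tending to 0, F(r) <= F(s) <= s^2 |u'(s)|^2 by monotonicity and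
   [potential_ge0]. *)
apply: (cvgr_to_ge sq0); near=> s.
have s0 : 0 < s by near: s; exact: nbhs_right_gt.
have sr : s <= r by near: s; exact: nbhs_right_le.
rewrite (le_trans (pohozaev_nincr s0 sr)) // /pohozaev.
have [_ dus] := dudu s s0.
have := potential_ge0 (ltW s0); rewrite derive1E dus sqnorm3E !exprMn -!mulrDr; lra.
Unshelve. all: by end_near. Qed.

(** One-sided continuity at 0 is recovered from the convergent difference quotient, multiplied back
    by [h]. *)
Lemma profile_cvg0 : u r @[r --> 0^'+] --> u 0.
Proof.
have [_ [du [du0 _ _]] _ _ _] := hu.
have h0 : h *: (h^-1 *: (u h - u 0)) @[h --> 0^'+] --> 0 *: du 0.
  by apply: cvgZ => //; exact: cvg_at_right_filter.
have h1 : h *: (h^-1 *: (u h - u 0)) + u 0 @[h --> 0^'+] --> 0 *: du 0 + u 0.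
  by apply: cvgD => //; exact: cvg_cst.
rewrite scale0r add0r in h1.
have uE : {near (0 : R)^'+, (fun h => h *: (h^-1 *: (u h - u 0)) + u 0) =1 u}.
  near=> h; have hn0 : h != 0 by rewrite gt_eqF //; near: h; exact: nbhs_right_gt.
  by rewrite scalerA divff // scale1r subrK.
by apply: cvg_trans h1; exact: near_eq_cvg uE.
Unshelve. all: by end_near. Qed.

(** If F vanishes, so does F' = -(4n - 4) r |u'|^2. As n >= 2, the factor 4n - 4 is nonzero, which
    forces u' = 0; for n = 1 this argument would break down. *)
Lemma pohozaev_eq0_cst : (forall r : R, 0 < r -> pohozaev n u r = 0) ->
  forall r : R, 0 <= r -> u r = u 0.
Proof.
move=> F0 r r0; have [_ _ C2 _ _] := hu.
have du0 (t : R) : 0 < t -> is_derive t 1 u 0.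
  move=> t0; have [dut _ _] := C2 t t0.
  have := derivable_is_derive1 dut; rewrite (_ : derive1 u t = 0) //.
  have := @near_eq_is_derive R _ _ _ (cst 0 : R -> R) t 1 _ _
    (is_derive_pohozaev_profile hu t0).
  case=> [|_].
    by near=> s; rewrite F0 //; near: s; exact: lt_nbhsr.
  rewrite derive_cst => /esym/eqP; rewrite !mulf_eq0 oppr_eq0 (gt_eqF t0) orbF.
  have -> /= : (4 * n%:R - 4 == 0 :> R) = false by apply/eqP; have := n2R; lra.
  by move=> /eqP/sqnorm_eq0.
apply/rowP => i; apply: (@is_derive0_cst_halfline R (fun t => u t 0 i) 0 r _ _ r0).
- apply/continuous_within_itvcyP; split.
    move=> t; rewrite in_itv /= andbT => /du0/(is_derive_coord 0 i)[dt _].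
    exact/differentiable_continuous/derivable1_diffP.
  by apply: (cvg_comp u (fun M : 'rV[R]_3 => M 0 i) profile_cvg0);
    exact: coord_continuous.
- move=> t /du0/(is_derive_coord 0 i); by rewrite mxE.
Unshelve. all: by end_near. Qed.

Lemma energy_density_lower_bound :
  (exists r s : R, 0 <= r /\ 0 <= s /\ u r <> u s) ->
  exists r0 c : R, [/\ 0 < r0, 0 < c &
    forall r : R, r0 <= r -> c / r ^+ 2 <= energy_density n u r].
Proof.
move=> [r [s [r0 [s0 urs]]]].
have [t [t0 Ft]] : exists t : R, 0 < t /\ pohozaev n u t < 0.
  apply: contrapT => noF; apply: urs.
  suff ucst : forall r : R, 0 <= r -> u r = u 0 by rewrite !ucst.
  apply: pohozaev_eq0_cst => t t0; apply/eqP; rewrite eq_le pohozaev_le0 //=.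
  by rewrite leNgt; apply/negP => Ft; apply: noF; exists t.
(* For r >= t, r^2 times the density equals 2 r^2 |u'|^2 - F(r), which is at least -F(r) >=
   -F(t). *)
exists t, (- pohozaev n u t); split => //; first by rewrite oppr_gt0.
move=> {r s r0 s0 urs} r tr; have r0 := lt_le_trans t0 tr.
have := pohozaev_nincr t0 tr; rewrite energy_densityE // => Fr.
rewrite ler_pdivrMr ?exprn_gt0 // mulrDl divfK ?expf_neq0 ?gt_eqF //.
have := mulr_ge0 (sqnorm_ge0 (derive1 u r)) (sqr_ge0 r).
move: Fr; rewrite [X in X <= _]/pohozaev; lra.
Qed.

End Profile.

(** * Divergence of the energy on large cubes *)

Unset Implicit Arguments.

Theorem corollary2p7 (R : realType) (n : nat) (hn : (2 <= n)%N)
    (u : R -> 'rV[R]_3) (hu : harmonic_profile n u)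
    (hnc : exists r s : R, 0 <= r /\ 0 <= s /\ u r <> u s) :
  energy n u = +oo%E.
Proof.
have [r0 [c [r00 c0 densc]]] := energy_density_lower_bound hn hu hnc.
have n0 : 0 < n%:R :> R by rewrite ltr0n (leq_trans _ hn).
apply/eqyP => A A0.
(* The three bounds on [L] serve in turn to compare powers of [L], to reach the region of the
   density bound, and to get c L / (8n) >= 2A. *)
pose L := Num.max (Num.max 1 r0) (16 * n%:R * A / c).
have L1 : 1 <= L by rewrite /L !le_max lexx.
have Lr0 : r0 <= L by rewrite /L !le_max lexx orbT.
have LA : 16 * n%:R * A / c <= L by rewrite /L !le_max lexx !orbT.
have L0 : 0 < L by exact: lt_le_trans L1.
pose B : set (Rn R (2 * n)) := [set x | forall i, [set` `[L, 2 * L]] (tnth x i)].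
have k0 : 0 <= c / ((2 * n)%:R * (4 * L ^+ 2)).
  by rewrite divr_ge0 ?mulr_ge0 ?sqr_ge0 // ltW.
have intB := @integral_ge_cst_on _ _ R (lebesgue_Rn R (2 * n))
  (fun x => energy_density n u (enorm x)) B
  (c / ((2 * n)%:R * (4 * L ^+ 2))).
(* The factor 1/2 of the energy moves across: the integral has to reach 2A. *)
rewrite /energy muleC -lee_pdivrMr // -EFinM.
apply: le_trans (intB _ k0 _ _) => {intB}.
- rewrite /B lebesgue_Rn_cube; last by rewrite mulr_natl mulr2n ltrDl.
  rewrite lee_fin (_ : 2 * L - L = L); last by ring.
  (* The cube has volume L^(2n) >= L^4 because n >= 2, and this outweighs the L^2 in the denominator
     of the density bound: the product is at least c L^2 / (8n). *)
  have L4 : L ^+ 4 <= L ^+ (2 * n) by rewrite ler_weXn2l // (leq_mul2l 2 2).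
  rewrite (le_trans _ (ler_wpM2l k0 L4)) //.
  rewrite (_ : _ * L ^+ 4 = c * L ^+ 2 / (8 * n%:R)); last first.
    by rewrite natrM; field; rewrite !gt_eqF.
  rewrite ler_pdivlMr ?mulr_gt0 //.
  have : 16 * n%:R * A <= c * L by move: LA; rewrite ler_pdivrMr // [L * c]mulrC.
  have : c * L <= c * L ^+ 2 by rewrite ler_pM2l // expr2 ler_peMl // ltW.
  by rewrite invrK; lra.
- by apply: (@measurable_box R (2 * n) (fun=> [set` `[L, 2 * L]])) => i;
    exact: measurable_itv.
- by move=> x; apply: energy_density_ge0 => //; exact: enorm_ge0.
- move=> x Bx; have m0 : (0 < 2 * n)%N by rewrite muln_gt0 (leq_trans _ hn).
  have xB i : L <= tnth x i <= 2 * L by have := Bx i; rewrite /= in_itv.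
  have [xL x2L] := enorm_cube m0 (ltW L0) xB.
  have x0 : 0 < enorm x by exact: lt_le_trans xL.
  apply: le_trans (densc _ (le_trans Lr0 xL)).
  by rewrite ler_pM2l // lef_pV2 ?posrE ?exprn_gt0 // !mulr_gt0 ?exprn_gt0 // ltr0n.
Qed.
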